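(* Let $\alpha,\gamma,\nu_1,\nu_2,D,\kappa_u,\kappa_{CP},\kappa_{SP},\zeta>0$, $0<\hat N\le N$ and $\kappa_{CP}\zeta>e$. Consider the infinitely repeated game between a short-sighted content provider (CP) and a short-sighted service provider (SP) described in the context. The possible asymptotically stable outcomes $(d,y,p,z,b)$ of the game are: 1. (no sponsoring) $(-,0,-,0,-)$: no sponsoring is offered, none taken; 2. (maximum bit sponsoring) $(\kappa_u\hat N,\,1,\,\alpha\kappa_u,\,1,\,\hat N)$; if this is the stable outcome then $\kappa_u\le\frac1\zeta$; 3. (minimum quality sponsoring) $\left(d,\,1,\,\frac{\alpha\log(\kappa_{CP}\zeta)}{\zeta},\,1,\,\zeta d\right)$; if this is the stable outcome then $\kappa_u=\frac1\zeta$ and $0<d\le\frac{\hat N}{\zeta}$; 4. (interior stable points) $\left(N\kappa_u-\frac{\nu_2}{\nu_1}D,\,1,\,\alpha\kappa_u,\,1,\,N-\frac{\nu_2}{\kappa_u\nu_1}D\right)$; if this is the stable outcome then $\kappa_u\le\frac1\zeta$ and $0<b=N-\frac{\nu_2}{\kappa_u\nu_1}D\le\hat N$. (Existence of a stable outcome is not asserted; the market may be unstable.)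
   Context: One-shot game at epoch $t$ with demand $d_t\ge0$ (convention $\log0=-\infty$); both players know $d_t$ and maximize their payoff at epoch $t$ only. CP (stage 2): given the price $p_t$ per sponsored bit, she solves $\max_{b_t>0}u_{CP,t}(b_t)$ subject to $b_t/d_t\ge\zeta$ and $b_t\le\hat N$, where $u_{CP,t}(b_t)=\alpha d_t\log(\kappa_{CP}b_t/d_t)-p_tb_t$ for $d_t>0$ (and $-p_tb_t$ for $d_t=0$). She exits ($z_t=0$) if $d_t=0$, if the problem is infeasible, or if the optimal value is negative; otherwise she joins ($z_t=1$) and sponsors the maximizer $b_t=b_t^*(p_t)$. SP (stage 1): if the CP joins, the SP's utility is $$u_{SP,t}(p_t)=p_tb_t^*+\nu_1d_t\log\left(\frac{\kappa_{SP}b_t^*}{d_t}\right)+\nu_2D\log\left(\kappa_{SP}\frac{N-b_t^*}{D}\right),\qquad b_t^*=b_t^*(p_t).$$ The SP maximizes this over prices for which the CP joins. She does not offer the program ($y_t=0$) if $d_t=0$, if no price makes the CP join, or if the maximum is less than the no-sponsoring utility $\nu_2D\log(\kappa_{SP}N/D)$; otherwise she offers it ($y_t=1$) at a maximizing price $p_t$. Dynamics: the one-shot game is repeated at every epoch with these (subgame perfect equilibrium) strategies, and the demand evolves by $d_{t+1}=d_t\left(1+\gamma\log\left(\kappa_u\frac{b_t}{d_t}\right)\right)^+$ if $d_t>0$ and $d_{t+1}=0$ if $d_t=0$, where $x^+=\max\{x,0\}$. If $d_t=0$ or one of the players exits the sponsoring program, the game ends, and this is the stable outcome of no sponsoring,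 denoted $(-,0,-,0,-)$. Stability: the market is called stable if and only if the demand is asymptotically stable, i.e. $\lim_{t\to\infty}|d_{t+1}-d_t|=0$. An asymptotically stable outcome is the 5-tuple $(d,y,p,z,b)$ of demand, SP's offering decision, price per bit, CP's participation decision and number of sponsored bits in which such equilibrium play settles asymptotically when the market is stable.
   Formalization: A play in which sponsoring continues forever while the demand tends to 0 is counted as settling in the no-sponsoring outcome; sponsoring outcomes are required to have nonzero limit demand, since otherwise (0,1,p,1,0) could occur and is not on the list. *)

(* Defs.v *)
From HB Require Import structures.
From mathcomp Require Import all_boot all_order all_algebra.
From mathcomp Require Import boolp classical_sets functions reals ereal.
From mathcomp Require Import topology normedtype sequences exp.

Set Implicit Arguments.
Unset Strict Implicit.
Unset Printing Implicit Defensive.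

Import Order.TTheory GRing.Theory Num.Theory.
Import numFieldNormedType.Exports.

Local Open Scope classical_set_scope.
Local Open Scope ring_scope.

Record market (R : realType) := Market {
  alpha : R; gamma : R; nu1 : R; nu2 : R; Dconst : R;
  kappa_u : R; kappa_CP : R; kappa_SP : R;
  zeta : R; Nhat : R; Ntot : R }.

Section OneShotGame.
Context {R : realType} (M : market R).
Implicit Types d p b : R.

(* The real logarithm [ln] has the junk value [ln x = 0] for [x <= 0]. It is
   used below only where its argument is positive; the term in [Ntot - b],
   which can vanish, uses the extended [lne], for which [lne 0 = -oo]. *)

Definition cp_utility d p b : R :=
  if 0 < d then alpha M * d * ln (kappa_CP M * b / d) - p * b else - (p * b).

Definition cp_feasible d b : Prop :=
  [/\ 0 < b, zeta M <= b / d & b <= Nhat M].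

Definition cp_optimal d p b : Prop :=
  cp_feasible d b /\
  forall b', cp_feasible d b' -> cp_utility d p b' <= cp_utility d p b.

Definition cp_exits d p : Prop :=
  [\/ d = 0, ~ (exists b, cp_feasible d b)
    | exists b, cp_optimal d p b /\ cp_utility d p b < 0].

(* At price [p] the CP joins and sponsors [b] bits. *)
Definition cp_joins d p b : Prop := ~ cp_exits d p /\ cp_optimal d p b.

Definition sp_utility d p b : \bar R :=
  ((p * b + nu1 M * d * ln (kappa_SP M * b / d))%:E
   + (nu2 M * Dconst M)%:E
     * lne (kappa_SP M * ((Ntot M - b) / Dconst M))%:E)%E.

Definition sp_no_sponsoring_utility : \bar R :=
  (nu2 M * Dconst M * ln (kappa_SP M * Ntot M / Dconst M))%:E.

(* [p] maximizes the SP's utility over the prices at which the CP joins, and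
   [b] is the CP's response to [p]. No sign constraint is put on prices. *)
Definition sp_optimal d p b : Prop :=
  cp_joins d p b /\
  forall p' b', cp_joins d p' b' ->
    (sp_utility d p' b' <= sp_utility d p b)%E.

Definition sp_exits d : Prop :=
  [\/ d = 0, ~ (exists p b, cp_joins d p b)
    | exists p b, sp_optimal d p b /\
        (sp_utility d p b < sp_no_sponsoring_utility)%E].

Definition sp_strategy d (y : bool) p : Prop :=
  if y then ~ sp_exits d /\ (exists b, sp_optimal d p b) else sp_exits d.

Definition cp_strategy d (y : bool) p (z : bool) b : Prop :=
  if y then (if z then cp_joins d p b else cp_exits d p) else z = false.

Definition one_shot_equilibrium d (y : bool) p (z : bool) b : Prop :=
  sp_strategy d y p /\ cp_strategy d y p z b.

Definition next_demand d b : R :=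
  if 0 < d then d * Num.max (1 + gamma M * ln (kappa_u M * (b / d))) 0 else 0.

End OneShotGame.

(* A play of the repeated game. The price is meaningful only at epochs where
   the SP offers, the bits only where the CP joins, and everything only up to
   the first epoch where some player exits. *)
Record play (R : realType) := Play {
  demand : nat -> R;
  offers : nat -> bool;
  price : nat -> R;
  joins : nat -> bool;
  bits : nat -> R }.

Section RepeatedGame.
Context {R : realType} (M : market R).
Implicit Type x : play R.

Definition sponsoring_at x (t : nat) : bool := offers x t && joins x t.

Definition equilibrium_play x : Prop :=
  0 <= demand x 0%N /\
  forall t : nat, (forall s : nat, (s < t)%N -> sponsoring_at x s) ->
    one_shot_equilibrium M
      (demand x t) (offers x t) (price x t) (joins x t) (bits x t) /\
    (sponsoring_at x t ->
     demand x t.+1 = next_demand M (demand x t) (bits x t)).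

(* In an equilibrium play this covers zero demand, at which the SP exits. *)
Definition game_ends x : Prop := exists t, ~~ sponsoring_at x t.

Definition market_stable x : Prop :=
  (fun t => `|demand x t.+1 - demand x t|) @ \oo --> (0 : R).

(* [None] stands for the dash in the components of [(-, 0, -, 0, -)]. *)
Definition outcome : Type :=
  (option R * bool * option R * bool * option R)%type.

Definition no_sponsoring : outcome := (None, false, None, false, None).

Definition sponsoring (d p b : R) : outcome :=
  (Some d, true, Some p, true, Some b).

(* Sponsoring can continue forever with a positive demand tending to [0]. At
   zero demand there is no game, so such a play settles in no sponsoring. *)
Inductive settles_in x : outcome -> Prop :=
| settles_ended : game_ends x -> settles_in x no_sponsoring
| settles_vanishing :
    ~ game_ends x -> market_stable x -> demand x @ \oo --> (0 : R) ->
    settles_in x no_sponsoring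
| settles_sponsoring (d p b : R) :
    ~ game_ends x -> market_stable x -> d != 0 ->
    demand x @ \oo --> d -> price x @ \oo --> p -> bits x @ \oo --> b ->
    settles_in x (sponsoring d p b).

Definition asymptotically_stable_outcome (o : outcome) : Prop :=
  exists x, equilibrium_play x /\ settles_in x o.

End RepeatedGame.

Arguments outcome R : clear implicits.
Arguments no_sponsoring {R}.

(* Main.v *)
(* Along a play that never ends, every epoch is in one of three regimes.
   Concavity of the CP's utility shows that she answers with the bits b = zeta d
   or pays p b <= alpha d, and that every price alpha d / b with
   zeta d <= b <= Nhat makes her sponsor exactly b. The SP therefore either
   extracts the whole surplus at b = zeta d, or collects p b = alpha d, and then
   b = Nhat or b satisfies the first-order condition
   nu1 d / b = nu2 D / (N - b). These relations are closed, so one of them holds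
   for the limits, and passing to the limit in the demand recursion gives
   d = kappa_u b. *)
Require Import Defs.
From mathcomp Require Import all_boot all_order all_algebra.
From mathcomp Require Import boolp classical_sets reals ereal.
From mathcomp Require Import topology normedtype sequences exp.
From mathcomp Require Import ring lra.

Set Implicit Arguments.
Unset Strict Implicit.
Unset Printing Implicit Defensive.

Import Order.TTheory GRing.Theory Num.Theory.
Import numFieldNormedType.Exports.
Local Open Scope classical_set_scope.
Local Open Scope ring_scope.

(** * One-sided first-order conditions for a concave logarithmic payoff *)

Section LogConcave.
Context {R : realType}.
Implicit Types (A B N a b k p x l u : R).

Lemma ln_tangent x b : 0 < x -> 0 < b -> ln b - ln x <= (b - x) / x.
Proof.
move=> x0 b0; rewrite -ln_div ?posrE//.
have -> : b / x = 1 + (b - x) / x by field; rewrite gt_eqF.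
apply: le_ln1Dx; rewrite ltr_pdivlMr//; lra.
Qed.

Lemma ln_scale k b a : 0 < k -> 0 < a -> 0 < b ->
  ln (k * b / a) = ln b + ln (k / a).
Proof.
by move=> k0 a0 b0; rewrite -lnM ?posrE ?divr_gt0//; congr ln; ring.
Qed.

(** Shape shared by both utilities as functions of the bits, up to constants: the CP has [B = 0];
    for the SP [p = 0], her revenue being kept apart. *)
Definition log_payoff A B N p x : R := A * ln x + B * ln (N - x) - p * x.

(** The derivative of [log_payoff] in [x]. *)
Definition log_margin A B N p x : R := A / x - B / (N - x) - p.

Lemma log_payoff_tangent A B N p b x :
  0 <= A -> 0 <= B -> 0 < b -> b < N -> 0 < x -> x < N ->
  log_payoff A B N p b <=
  log_payoff A B N p x + log_margin A B N p x * (b - x).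
Proof.
move=> A0 B0 b0 bN x0 xN; rewrite /log_payoff /log_margin.
have h1 := ler_wpM2l A0 (ln_tangent x0 b0).
have Nx : 0 < N - x by lra.
have Nb : 0 < N - b by lra.
have h2 := ler_wpM2l B0 (ln_tangent Nx Nb).
have -> : (A / x - B / (N - x) - p) * (b - x) =
  A * ((b - x) / x) + B * ((N - b - (N - x)) / (N - x)) - p * (b - x).
  by field; rewrite !gt_eqF.
move: h1 h2; set u := (b - x) / x; set v := (N - b - _) / _.
rewrite !mulrBr; lra.
Qed.

Lemma log_margin_continuous A B N p b : 0 < b -> b < N ->
  log_margin A B N p x @[x --> b] --> log_margin A B N p b.
Proof.
move=> b0 bN; apply: cvgB; last exact: cvg_cst.
apply: cvgB.
  by apply: cvgM; [exact: cvg_cst|apply: cvgV; [lra|exact: cvg_id]].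
apply: cvgM; first exact: cvg_cst.
by apply: cvgV; [lra|apply: cvgB; [exact: cvg_cst|exact: cvg_id]].
Qed.

(** For [x] just left of [b], maximality and the tangent at [x] give f(x) <= f(b) <= f(x) + f'(x)(b
    - x), so f'(x) >= 0; continuity of f' carries this to [b]. The next lemma is the mirror image
    from the right. *)
Lemma log_margin_ge0 A B N p b l :
  0 <= A -> 0 <= B -> b < N -> 0 < l -> l < b ->
  (forall x, l <= x <= b ->
     log_payoff A B N p x <= log_payoff A B N p b) ->
  0 <= log_margin A B N p b.
Proof.
move=> A0 B0 bN l0 lb fmax.
have b0 : 0 < b by lra.
apply: (cvgr_to_ge (cvg_at_left_filter (@log_margin_continuous A B N p b b0 bN))).
near=> x.
have lx : l < x by near: x; exact: nbhs_left_gt.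
have xb : x < b by near: x; exact: nbhs_left_lt.
have := @log_payoff_tangent A B N p b x A0 B0 ltac:(lra) bN ltac:(lra) ltac:(lra).
have := fmax x ltac:(apply/andP; split; lra).
move=> h1 h2; rewrite -(pmulr_lge0 _ (_ : 0 < b - x)); lra.
Unshelve. all: by end_near. Qed.

Lemma log_margin_le0 A B N p b u :
  0 <= A -> 0 <= B -> 0 < b -> b < N -> b < u ->
  (forall x, b <= x <= u -> x < N ->
     log_payoff A B N p x <= log_payoff A B N p b) ->
  log_margin A B N p b <= 0.
Proof.
move=> A0 B0 b0 bN bu fmax.
apply: (cvgr_to_le (cvg_at_right_filter (@log_margin_continuous A B N p b b0 bN))).
near=> x.
have bx : b < x by near: x; exact: nbhs_right_gt.
have xu : x < u by near: x; exact: nbhs_right_lt.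
have xN : x < N by near: x; exact: nbhs_right_lt.
have := @log_payoff_tangent A B N p b x A0 B0 ltac:(lra) bN ltac:(lra) ltac:(lra).
have := fmax x ltac:(apply/andP; split; lra) xN.
move=> h1 h2; rewrite -(pmulr_lle0 _ (_ : 0 < x - b)); lra.
Unshelve. all: by end_near. Qed.

End LogConcave.

(** * Best responses and equilibria of the one-shot game *)

Section OneShot.
Context {R : realType} (M : market R).
Context (halpha : 0 < alpha M) (hnu1 : 0 < nu1 M) (hnu2 : 0 < nu2 M).
Context (hD : 0 < Dconst M) (hkappa_CP : 0 < kappa_CP M).
Context (hkappa_SP : 0 < kappa_SP M) (hzeta : 0 < zeta M).
Context (hN : Nhat M <= Ntot M).
Context (hquality : expR 1 < kappa_CP M * zeta M).
Implicit Types d p b : R.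

Definition min_quality_price : R :=
  alpha M * ln (kappa_CP M * zeta M) / zeta M.

Lemma ln_quality_gt1 : 1 < ln (kappa_CP M * zeta M).
Proof. by rewrite -[X in X < _]expRK ltr_ln// posrE ?expR_gt0 ?mulr_gt0. Qed.

Lemma cp_feasibleE d b : 0 < d ->
  cp_feasible M d b <-> zeta M * d <= b /\ b <= Nhat M.
Proof.
move=> d0; rewrite /cp_feasible ler_pdivlMr//; split; first by case.
move=> [db bN]; split => //.
by apply: lt_le_trans db; rewrite mulr_gt0.
Qed.

(** [N] is free because its logarithm has coefficient 0; it is chosen large enough for the bounds on
    [log_payoff] to apply. *)
Lemma cp_utilityE N d p b : 0 < d -> 0 < b ->
  cp_utility M d p b =
  log_payoff (alpha M * d) 0 N p b + alpha M * d * ln (kappa_CP M / d).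
Proof.
move=> d0 b0; rewrite /cp_utility d0 ln_scale// /log_payoff; ring.
Qed.

(** With room to sponsor fewer bits, the marginal utility [alpha M * d / b - p] cannot be
    negative. *)
Lemma cp_optimal_price_le d p b : 0 < d -> cp_optimal M d p b ->
  zeta M * d < b -> p * b <= alpha M * d.
Proof.
move=> d0 [/(cp_feasibleE _ d0)[_ bN] bmax] db.
have l0 : 0 < zeta M * d by rewrite mulr_gt0.
have b0 : 0 < b by lra.
have := @log_margin_ge0 _ (alpha M * d) 0 (b + 1) p b (zeta M * d).
rewrite /log_margin mul0r subr0 subr_ge0 ler_pdivlMr//.
apply => //; [by rewrite ltW// mulr_gt0|lra|].
move=> x /andP[lx xb].
have := bmax x; rewrite !(cp_utilityE (b + 1))//; last lra.
by rewrite lerD2r; apply; apply/cp_feasibleE => //; split => //; lra.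
Qed.

Lemma cp_optimal_price_ge d p b : 0 < d -> cp_optimal M d p b ->
  b < Nhat M -> alpha M * d <= p * b.
Proof.
move=> d0 [/(cp_feasibleE _ d0)[db _] bmax] bN.
have l0 : 0 < zeta M * d by rewrite mulr_gt0.
have b0 : 0 < b by lra.
have := @log_margin_le0 _ (alpha M * d) 0 (b + 1) p b (Nhat M).
rewrite /log_margin mul0r subr0 subr_le0 ler_pdivrMr//.
apply => //; [by rewrite ltW// mulr_gt0|lra|].
move=> x /andP[bx xN] _.
have := bmax x; rewrite !(cp_utilityE (b + 1))//; last lra.
by rewrite lerD2r; apply; apply/cp_feasibleE => //; split => //; lra.
Qed.

(** If [b < b'] were both optimal, room above [b] and below [b'] would give
    [p * b' <= alpha M * d <= p * b] with [p > 0]. *)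
Lemma cp_optimal_unique d p b b' : 0 < d ->
  cp_optimal M d p b -> cp_optimal M d p b' -> b = b'.
Proof.
move=> d0; wlog: b b' / b < b'.
  by move=> wl hb hb'; have [|/wl ->|] := ltgtP b b' => // /wl; apply.
move=> bb' hb hb'; exfalso.
have [/(cp_feasibleE _ d0)[db _] _] := hb.
have [/(cp_feasibleE _ d0)[_ bN] _] := hb'.
have ad0 : 0 < alpha M * d by rewrite mulr_gt0.
have l0 : 0 < zeta M * d by rewrite mulr_gt0.
have := cp_optimal_price_ge d0 hb ltac:(lra).
have := cp_optimal_price_le d0 hb' ltac:(lra).
move=> le1 le2.
have p0 : 0 < p by rewrite -(pmulr_lgt0 _ (_ : 0 < b)); lra.
suff : p * b < p * b' by lra.
by rewrite ltr_pM2l.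
Qed.

(** The last premise is the variational inequality u'(b)(b' - b) <= 0 multiplied by [b]; concavity
    makes it sufficient. *)
Lemma cp_joins_intro d p b : 0 < d -> cp_feasible M d b ->
  0 <= cp_utility M d p b ->
  (forall b', cp_feasible M d b' ->
     alpha M * d * (b' - b) <= p * b * (b' - b)) ->
  cp_joins M d p b.
Proof.
move=> d0 fb u0 bmax.
have hopt : cp_optimal M d p b.
  split=> // b' fb'.
  have b0 : 0 < b by case: fb.
  have b'0 : 0 < b' by case: fb'.
  rewrite !(cp_utilityE (b + b'))//.
  have := @log_payoff_tangent _ (alpha M * d) 0 (b + b') p b' b.
  have -> : log_margin (alpha M * d) 0 (b + b') p b * (b' - b) =
    (alpha M * d * (b' - b) - p * b * (b' - b)) / b.
    by rewrite /log_margin mul0r; field; rewrite gt_eqF.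
  move=> /(_ (ltW (mulr_gt0 halpha d0)) (lexx _) b'0 ltac:(lra) b0 ltac:(lra)).
  have : (alpha M * d * (b' - b) - p * b * (b' - b)) / b <= 0.
    by rewrite pmulr_lle0 ?invr_gt0// subr_le0 bmax.
  lra.
split=> //; case.
- by move=> dE; rewrite dE ltxx in d0.
- by apply; exists b.
- move=> [b' [[fb' b'max] u'0]].
  by have := le_lt_trans (b'max _ fb) u'0; rewrite ltNge u0.
Qed.

(** This price leaves the CP utility exactly 0. Since [kappa_CP M * zeta M] exceeds e, her payment
    is at least [alpha M * d], so extra bits do not pay. *)
Lemma cp_joins_min_quality d : 0 < d -> zeta M * d <= Nhat M ->
  cp_joins M d min_quality_price (zeta M * d).
Proof.
move=> d0 dN; have ln1 := ln_quality_gt1.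
apply: cp_joins_intro => //; first exact/cp_feasibleE.
  rewrite /cp_utility d0 /min_quality_price mulrA mulfK ?gt_eqF//.
  rewrite le_eqVlt; apply/orP; left; apply/eqP; field; rewrite ?gt_eqF//.
move=> b' /(cp_feasibleE _ d0)[db' _].
apply: ler_wpM2r; first lra.
have -> : min_quality_price * (zeta M * d) =
  alpha M * d * ln (kappa_CP M * zeta M).
  by rewrite /min_quality_price; field; rewrite gt_eqF.
by rewrite ler_peMr ?ltW// mulr_gt0.
Qed.

(** The price makes the marginal utility vanish at [b]; the utility there is [alpha M * d] times a
    logarithm minus 1, and that logarithm exceeds 1. *)
Lemma cp_joins_above_quality d b : 0 < d -> zeta M * d <= b -> b <= Nhat M ->
  cp_joins M d (alpha M * d / b) b.
Proof.
move=> d0 db bN; have ln1 := ln_quality_gt1.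
have l0 : 0 < zeta M * d by rewrite mulr_gt0.
have b0 : 0 < b by lra.
apply: cp_joins_intro => //; first exact/cp_feasibleE.
  rewrite /cp_utility d0 divfK ?gt_eqF// subr_ge0 ler_peMr ?mulr_ge0 ?ltW//.
  apply: (lt_le_trans ln1); rewrite ler_ln ?posrE ?divr_gt0 ?mulr_gt0//.
  by rewrite ler_pdivlMr// -mulrA ler_pM2l.
by move=> b' _; rewrite divfK ?gt_eqF.
Qed.

Lemma sp_utilityE d p b : 0 < d -> 0 < b -> b < Ntot M ->
  sp_utility M d p b =
  (p * b + log_payoff (nu1 M * d) (nu2 M * Dconst M) (Ntot M) 0 b
   + (nu1 M * d * ln (kappa_SP M / d)
      + nu2 M * Dconst M * ln (kappa_SP M / Dconst M)))%:E.
Proof.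
move=> d0 b0 bN; have Nb : 0 < Ntot M - b by lra.
rewrite /sp_utility lne_EFin ?mulrA ?divr_gt0 ?mulr_gt0//.
rewrite -EFinM -EFinD !ln_scale// /log_payoff; congr (_%:E); ring.
Qed.

Lemma sp_utility_full d p b : b = Ntot M -> sp_utility M d p b = -oo%E.
Proof.
move=> ->; rewrite /sp_utility subrr mul0r mulr0 le0_lneNy//.
by rewrite gt0_muleNy ?lte_fin ?mulr_gt0.
Qed.

Lemma sponsoring_equilibrium d p b : 0 <= d ->
  one_shot_equilibrium M d true p true b ->
  [/\ 0 < d, zeta M * d <= b, b <= Nhat M &
   [\/ p = min_quality_price /\ b = zeta M * d,
       p * b = alpha M * d /\ b = Nhat M
     | p * b = alpha M * d /\
       nu1 M * d * (Ntot M - b) = nu2 M * Dconst M * b]].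
Proof.
rewrite le_eqVlt => /predU1P[<-|d0] [[/= nexit [b0 spopt]] joins].
  by exfalso; apply: nexit; constructor.
have b0E : b0 = b.
  by case: spopt joins => [[_ ?] _] [_ ?]; exact: (@cp_optimal_unique d p).
rewrite {b0}b0E in spopt.
have [cpnexit cpopt] := joins.
have [/(cp_feasibleE _ d0)[db bN] _] := cpopt.
have l0 : 0 < zeta M * d by rewrite mulr_gt0.
have b0 : 0 < b by lra.
(* Selling all of [Ntot M] yields utility -oo, so the SP would rather exit. *)
have bNtot : b < Ntot M.
  rewrite lt_neqAle (le_trans bN)// andbT; apply/eqP => bE.
  apply: nexit; constructor 3; exists p, b; split=> //.
  by rewrite sp_utility_full// ltNyr.
have [_ spmax] := spopt.
have payoff_max p' b' : cp_joins M d p' b' -> 0 < b' -> b' < Ntot M ->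
    p' * b' + log_payoff (nu1 M * d) (nu2 M * Dconst M) (Ntot M) 0 b' <=
    p * b + log_payoff (nu1 M * d) (nu2 M * Dconst M) (Ntot M) 0 b.
  move=> /spmax + b'0 b'N.
  by rewrite !sp_utilityE// lee_fin lerD2r.
(* At minimum quality, the CP's participation bounds the price above and the SP's optimality bounds
   it below. *)
split=> //; have [bE|dneb] := eqVneq b (zeta M * d).
  constructor 1; split=> //; apply/le_anti/andP; split.
    have u0 : 0 <= cp_utility M d p b.
      rewrite leNgt; apply/negP => u0; apply: cpnexit.
      by constructor 3; exists b.
    rewrite ler_pdivlMr// -(ler_pM2r d0) -mulrA -bE.
    move: u0; rewrite /cp_utility d0 subr_ge0 {2}bE.
    by rewrite mulrA mulfK ?gt_eqF// mulrAC.
  have := payoff_max _ _ (cp_joins_min_quality d0 ltac:(lra)).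
  by rewrite -bE => /(_ b0 bNtot); rewrite lerD2r ler_pM2r.
have {dneb} db' : zeta M * d < b by rewrite lt_neqAle eq_sym dneb.
(* The SP could charge [alpha M * d / b] for the same bits, so her revenue is no smaller than
   [alpha M * d]. *)
have pbE : p * b = alpha M * d.
  apply/le_anti; rewrite cp_optimal_price_le//=.
  have := payoff_max _ _ (cp_joins_above_quality d0 db bN) b0 bNtot.
  by rewrite lerD2r divfK ?gt_eqF.
have [bE|bneN] := eqVneq b (Nhat M); first by constructor 2.
constructor 3; split=> //.
have {bneN} bN' : b < Nhat M by rewrite lt_neqAle bneN.
(* Every price [alpha M * d / x] brings the same revenue, so only the logarithmic terms are
   compared. *)
have log_max x : zeta M * d <= x -> x <= Nhat M -> x < Ntot M ->
    log_payoff (nu1 M * d) (nu2 M * Dconst M) (Ntot M) 0 x <=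
    log_payoff (nu1 M * d) (nu2 M * Dconst M) (Ntot M) 0 b.
  move=> dx xN xNtot.
  have x0 : 0 < x by lra.
  have := payoff_max _ _ (cp_joins_above_quality d0 dx xN) x0 xNtot.
  by rewrite pbE divfK ?gt_eqF// lerD2l.
have A0 : 0 <= nu1 M * d by rewrite mulr_ge0// ltW.
have B0 : 0 <= nu2 M * Dconst M by rewrite mulr_ge0// ltW.
have ge0 : 0 <= log_margin (nu1 M * d) (nu2 M * Dconst M) (Ntot M) 0 b.
  apply: (log_margin_ge0 A0 B0 bNtot l0 db') => x /andP[dx xb].
  by apply: log_max => //; lra.
have le0 : log_margin (nu1 M * d) (nu2 M * Dconst M) (Ntot M) 0 b <= 0.
  apply: (log_margin_le0 A0 B0 b0 bNtot bN') => x /andP[bx xN] xNt.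
  by apply: log_max => //; lra.
have : log_margin (nu1 M * d) (nu2 M * Dconst M) (Ntot M) 0 b = 0.
  by apply/le_anti; rewrite le0.
rewrite /log_margin subr0 => /eqP; rewrite subr_eq0.
by rewrite eqr_div ?lt0r_neq0 ?subr_gt0// => /eqP.
Qed.

End OneShot.

(** * Passage to the limit along a play that never ends *)

Section Regimes.
Context {R : realType} (M : market R).
Implicit Types d p b : R.

(* A product of distances vanishing exactly on the union of the three regimes
   of [sponsoring_equilibrium]: by continuity the trichotomy passes to the
   limit without extracting subsequences. *)
Definition regime_gap d p b : R :=
  (`|p - min_quality_price M| + `|b - zeta M * d|) *
  (`|p * b - alpha M * d| + `|b - Nhat M|) *
  (`|p * b - alpha M * d|
   + `|nu1 M * d * (Ntot M - b) - nu2 M * Dconst M * b|).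

Lemma dist_pair_eq0 (a b a' b' : R) :
  `|a - b| + `|a' - b'| = 0 <-> a = b /\ a' = b'.
Proof.
split=> [/eqP|[-> ->]]; last by rewrite !subrr normr0 addr0.
by rewrite paddr_eq0// !normr_eq0 !subr_eq0 => /andP[/eqP-> /eqP->].
Qed.

Lemma regime_gap_eq0 d p b :
  regime_gap d p b = 0 <->
  [\/ p = min_quality_price M /\ b = zeta M * d,
      p * b = alpha M * d /\ b = Nhat M
    | p * b = alpha M * d /\
      nu1 M * d * (Ntot M - b) = nu2 M * Dconst M * b].
Proof.
rewrite /regime_gap; split=> [/eqP|].
  rewrite !mulf_eq0 -orbA => /or3P[] /eqP /dist_pair_eq0 h;
  by [constructor 1|constructor 2|constructor 3].
by case=> /dist_pair_eq0 ->; rewrite ?mulr0 ?mul0r ?mulr0.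
Qed.

Lemma cvg_regime_gap (u v w : nat -> R) d p b :
  u @ \oo --> d -> v @ \oo --> p -> w @ \oo --> b ->
  regime_gap (u n) (v n) (w n) @[n --> \oo] --> regime_gap d p b.
Proof.
move=> ud vp wb.
have cst (c : R) : (fun=> c) @ \oo --> c by exact: cvg_cst.
have mul_d (c : R) : c * u n @[n --> \oo] --> c * d by exact: cvgM.
have pay : `|v n * w n - alpha M * u n| @[n --> \oo] --> `|p * b - alpha M * d|.
  by apply: cvg_norm; apply: cvgB => //; exact: cvgM.
apply: cvgM; [apply: cvgM|]; apply: cvgD => //; apply: cvg_norm; apply: cvgB => //.
- by apply: cvgM => //; exact: cvgB.
- exact: cvgM.
Qed.

Lemma sponsoring_play x :
  equilibrium_play M x -> ~ game_ends x ->
  (forall t, 0 < demand x t) /\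
  forall t,
    one_shot_equilibrium M (demand x t) true (price x t) true (bits x t) /\
    demand x t.+1 = next_demand M (demand x t) (bits x t).
Proof.
move=> [d0 eqx] endx.
have sp t : sponsoring_at x t.
  by apply: contrapT => /negP h; apply: endx; exists t.
have eqt t : one_shot_equilibrium M (demand x t) true (price x t) true (bits x t)
    /\ demand x t.+1 = next_demand M (demand x t) (bits x t).
  have [h1 h2] := eqx t (fun s _ => sp s).
  have /andP[ot jt] := sp t.
  by rewrite ot jt in h1; split => //; exact: h2.
split=> // t; rewrite lt0r; apply/andP; split.
  apply/eqP => dt; have [[[nexit _] _] _] := eqt t.
  by apply: nexit; constructor.
case: t => // t; have [_ ->] := eqt t.
by rewrite /next_demand; case: ifP => // /ltW dt; rewrite mulr_ge0// le_max lexx orbT.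
Qed.

Lemma next_demand_limit (u w : nat -> R) d b :
  0 < gamma M -> 0 < kappa_u M -> 0 < d -> 0 < b -> (forall t, 0 < u t) ->
  (forall t, u t.+1 = next_demand M (u t) (w t)) ->
  u @ \oo --> d -> w @ \oo --> b -> d = kappa_u M * b.
Proof.
move=> g0 k0 d0 b0 u0 unext ud wb.
(* Demand stays positive, so the truncation at 0 is never active. *)
have uE t : u t.+1 = u t * (1 + gamma M * ln (kappa_u M * (w t / u t))).
  have := u0 t.+1; rewrite unext /next_demand u0 pmulr_rgt0// lt_max ltxx orbF.
  by move=> /ltW/max_idPl ->.
have kbd0 : 0 < kappa_u M * (b / d) by rewrite mulr_gt0 ?divr_gt0.
have lnlim : ln (kappa_u M * (w t / u t)) @[t --> \oo]
    --> ln (kappa_u M * (b / d)).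
  apply: (continuous_cvg _ (continuous_ln kbd0)).
  apply: cvgM; first exact: cvg_cst.
  by apply: cvgM => //; apply: cvgV => //; rewrite gt_eqF.
have lim1 : u t.+1 @[t --> \oo] -->
    d * (1 + gamma M * ln (kappa_u M * (b / d))).
  under eq_fun do rewrite uE.
  apply: cvgM => //; apply: cvgD; first exact: cvg_cst.
  by apply: cvgM => //; exact: cvg_cst.
have lim2 : u t.+1 @[t --> \oo] --> d by rewrite cvg_shiftS.
(* Both limits of the shifted sequence agree, which forces the logarithm to vanish. *)
have dE : d * (1 + gamma M * ln (kappa_u M * (b / d))) = d.
  exact: norm_cvg_unique lim1 lim2.
have /eqP : gamma M * ln (kappa_u M * (b / d)) = 0.
  by apply: (mulfI (lt0r_neq0 d0)); rewrite mulr0; lra.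
rewrite mulf_eq0 gt_eqF//= ln_eq0// => /eqP kE.
by rewrite -[LHS]mul1r -kE; field; rewrite gt_eqF.
Qed.

End Regimes.

Theorem theorem3 (R : realType) (M : market R)
  (halpha : 0 < alpha M) (hgamma : 0 < gamma M)
  (hnu1 : 0 < nu1 M) (hnu2 : 0 < nu2 M) (hD : 0 < Dconst M)
  (hkappa_u : 0 < kappa_u M) (hkappa_CP : 0 < kappa_CP M)
  (hkappa_SP : 0 < kappa_SP M) (hzeta : 0 < zeta M)
  (hNhat : 0 < Nhat M) (hN : Nhat M <= Ntot M)
  (hquality : expR 1 < kappa_CP M * zeta M)
  (o : outcome R) (ho : asymptotically_stable_outcome M o) :
  [\/ o = no_sponsoring,
      o = sponsoring (kappa_u M * Nhat M) (alpha M * kappa_u M) (Nhat M) /\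
        kappa_u M <= 1 / zeta M,
      exists d : R,
        [/\ o = sponsoring d (alpha M * ln (kappa_CP M * zeta M) / zeta M)
                  (zeta M * d),
            kappa_u M = 1 / zeta M, 0 < d & d <= Nhat M / zeta M]
    | let b := Ntot M - nu2 M / (kappa_u M * nu1 M) * Dconst M in
        [/\ o = sponsoring (Ntot M * kappa_u M - nu2 M / nu1 M * Dconst M)
                  (alpha M * kappa_u M) b,
            kappa_u M <= 1 / zeta M, 0 < b & b <= Nhat M]].
Proof.
case: ho => x [eqx]; case; [by constructor 1|by constructor 1|].
move=> d p b endx _ dn0 xd xp xb.
have [x0 xstep] := sponsoring_play eqx endx.
have xcases t := sponsoring_equilibrium halpha hnu1 hnu2 hD hkappa_CP hkappa_SP
  hzeta hN hquality (ltW (x0 t)) (xstep t).1.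
have d0 : 0 < d.
  rewrite lt0r dn0 (cvgr_to_ge xd)//.
  by apply: nearW => t; exact: ltW.
have db : zeta M * d <= b.
  have lim : bits x t - zeta M * demand x t @[t --> \oo] --> b - zeta M * d.
    by apply: cvgB => //; apply: cvgM => //; exact: cvg_cst.
  rewrite -subr_ge0 (cvgr_to_ge lim)//.
  by apply: nearW => t; rewrite subr_ge0; case: (xcases t).
have bN : b <= Nhat M.
  by rewrite (cvgr_to_le xb)//; apply: nearW => t; case: (xcases t).
have b0 : 0 < b by apply: lt_le_trans db; rewrite mulr_gt0.
have dE : d = kappa_u M * b.
  exact: next_demand_limit hgamma hkappa_u d0 b0 x0 (fun t => (xstep t).2) xd xb.
(* Substitute [d = kappa_u M * b] into [zeta M * d <= b] and cancel [b]. *)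
have kz : kappa_u M <= 1 / zeta M.
  by rewrite ler_pdivlMr// -(ler_pM2r b0) mul1r mulrAC -dE mulrC.
have pE : p * b = alpha M * d -> p = alpha M * kappa_u M.
  by move=> pb; apply: (mulIf (lt0r_neq0 b0)); rewrite pb dE mulrA.
have gap0 : regime_gap M d p b = 0.
  have gapE t : regime_gap M (demand x t) (price x t) (bits x t) = 0.
    by apply/regime_gap_eq0; case: (xcases t).
  have := cvg_regime_gap (M := M) xd xp xb.
  under eq_fun do rewrite gapE.
  by move=> lim; apply: (norm_cvg_unique lim); exact: cvg_cst.
have [[pq bE]|[/pE -> bE]|[/pE -> bE]] := (regime_gap_eq0 M d p b).1 gap0.
- constructor 3; exists d; split=> //; first by rewrite pq bE.
  + apply: (mulIf (lt0r_neq0 b0)); rewrite -dE bE.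
    by field; rewrite gt_eqF.
  + by rewrite ler_pdivlMr// mulrC -bE.
- by constructor 2; rewrite dE bE.
- have bE' : b = Ntot M - nu2 M / (kappa_u M * nu1 M) * Dconst M.
    (* With [d = kappa_u M * b] a factor [b] cancels from the first-order condition, leaving a
       linear equation. *)
    have NbE : nu1 M * kappa_u M * (Ntot M - b) = nu2 M * Dconst M.
      by apply: (mulIf (lt0r_neq0 b0)); rewrite -bE dE; ring.
    have -> : nu2 M / (kappa_u M * nu1 M) * Dconst M = Ntot M - b.
      by rewrite mulrAC -NbE; field; rewrite !gt_eqF.
    by ring.
  constructor 4 => /=; rewrite -bE'; split=> //.
  rewrite dE bE'; congr sponsoring; field; rewrite !gt_eqF//.
Qed.
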